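(* Let Alice and Bob have generative models $M^A$ and $M^B$ with latents $\Lambda^A$ and $\Lambda^B$ respectively, and let $X_1,X_2$ be a pair of observables such that: - (Mediation) $X_1,X_2$ are independent given $\Lambda^A$ under model $M^A$, and the same two observables are independent given $\Lambda^B$ under model $M^B$; - (Agreement on Observables) $P[X_1,X_2\mid M^A]=P[X_1,X_2\mid M^B]$. Under those constraints, Alice can guarantee that her latent $\Lambda^A$ is a function of Bob's latent $\Lambda^B$ (written $\Lambda^A\leftarrow\Lambda^B\rightarrow\Lambda^A$) if and only if $\Lambda^A$ is a natural latent over $X_1,X_2$, meaning that it satisfies both the mediation condition (already assumed) and the redundancy condition $\Lambda^A\leftarrow X_j\rightarrow\Lambda^A$ for all $j\in\{1,2\}$.
   Context: Each agent $i\in\{A,B\}$ has a generative model $M^i$ encoding a distribution $P[X_1,X_2,\Lambda^i\mid M^i]$ over the observable random variables $X_1,X_2$ and latent random variable(s) $\Lambda^i$; the two agents may use completely different latents. Independence of $X_1,X_2$ given $\Lambda^i$ under $M^i$ means $P[X_1=x_1,X_2=x_2\mid\Lambda^i=\lambda,M^i]=\prod_{j=1}^2P[X_j=x_j\mid\Lambda^i=\lambda,M^i]$ for all $x_1,x_2,\lambda$. The notation $Y\leftarrow Z\rightarrow Y$ means that $Y$ is fully determined by $Z$, i.e. $Y$ is a deterministic function of $Z$. ''Alice can guarantee'' that $\Lambda^A$ is a function of $\Lambda^B$ means: with $M^A$ and $\Lambda^A$ given, $\Lambda^A\leftarrow\Lambda^B\rightarrow\Lambda^A$ holds for any model $M^B$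 and any latent(s) $\Lambda^B$ which Bob might use, subject to the Mediation and Agreement on Observables constraints. Here $\Lambda^A$ and $\Lambda^B$ are regarded as random variables jointly distributed with the common observables $X_1,X_2$.
   Formalization: Alice's latent is assumed to take values in a standard Borel space (e.g. countable discrete or R^n); for arbitrary measurable spaces the ''if'' direction fails. ''Is a function of'' means almost surely equal to a measurable function. *)

(* Defs.v *)
From HB Require Import structures.
From mathcomp Require Import all_boot all_order all_algebra.
From mathcomp Require Import all_classical all_reals all_analysis.

Set Implicit Arguments.
Unset Strict Implicit.
Unset Printing Implicit Defensive.

Import Order.TTheory GRing.Theory Num.Theory.
Local Open Scope classical_set_scope.
Local Open Scope ring_scope.

(* Spaces isomorphic, as measurable spaces, to a Borel subset of the line. This
   includes countable discrete spaces and R^n. Some such condition is needed on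
   Alice's latent: let X1 = X2 = LA = U be uniform on [0, 1], all three valued in
   the line with its Lebesgue measurable sets, and let LB = U be valued in the
   line with its Borel sets. Then mediation and redundancy hold, but no g
   measurable from the Borel sets to the Lebesgue ones has U = g U almost
   surely. *)
Definition standard_borel (R : realType) (d : measure_display)
    (T : measurableType d) : Prop :=
  exists phi : T -> R,
    [/\ measurable_fun setT phi, injective phi
      & forall A : set T, measurable A -> measurable (phi @` A)].

(* [q] is a version of the conditional probability l |-> P[E | z = l]. *)
Definition is_cond_prob (R : realType) (d dZ : measure_display)
    (T : measurableType d) (Z : measurableType dZ) (P : probability T R)
    (E : set T) (z : T -> Z) (q : Z -> R) : Prop :=
  [/\ measurable_fun setT q,
      P.-integrable setT (fun t => (q (z t))%:E)
    & forall C : set Z, measurable C ->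
        P (E `&` z @^-1` C) = (\int[P]_(t in z @^-1` C) (q (z t))%:E)%E].

(* P[x1 in B1, x2 in B2 | z = l] = P[x1 in B1 | z = l] * P[x2 in B2 | z = l]
   for almost all l. As versions of a conditional probability are almost surely
   equal, the choice of q1 and q2 does not matter. *)
Definition cond_indep (R : realType) (d d1 d2 dZ : measure_display)
    (T : measurableType d) (X1 : measurableType d1) (X2 : measurableType d2)
    (Z : measurableType dZ) (P : probability T R)
    (x1 : T -> X1) (x2 : T -> X2) (z : T -> Z) : Prop :=
  forall (B1 : set X1) (B2 : set X2), measurable B1 -> measurable B2 ->
    exists q1 q2 : Z -> R,
      [/\ is_cond_prob P (x1 @^-1` B1) z q1,
          is_cond_prob P (x2 @^-1` B2) z q2
        & is_cond_prob P (x1 @^-1` B1 `&` x2 @^-1` B2) z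
            (fun l => q1 l * q2 l)].

(* y <- z -> y *)
Definition determined_by (R : realType) (d dY dZ : measure_display)
    (T : measurableType d) (Y : measurableType dY) (Z : measurableType dZ)
    (P : probability T R) (y : T -> Y) (z : T -> Z) : Prop :=
  exists2 g : Z -> Y, measurable_fun setT g & {ae P, forall t, y t = g (z t)}.

(* A generative model over the observables X1, X2 and a latent L (several
   latents are a single one, valued in a product) is the joint distribution
   P[X1, X2, L]; the random variables are the coordinates. *)
Notation model X1 X2 L R := (probability (X1 * X2 * L)%type R).

Definition mediation (R : realType) (d1 d2 dL : measure_display)
    (X1 : measurableType d1) (X2 : measurableType d2) (L : measurableType dL)
    (M : model X1 X2 L R) : Prop :=
  cond_indep M (fun t => t.1.1) (fun t => t.1.2) (fun t => t.2).

Definition redundancy (R : realType) (d1 d2 dL : measure_display)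
    (X1 : measurableType d1) (X2 : measurableType d2) (L : measurableType dL)
    (M : model X1 X2 L R) : Prop :=
  determined_by M (fun t => t.2) (fun t => t.1.1) /\
  determined_by M (fun t => t.2) (fun t => t.1.2).

Definition natural_latent (R : realType) (d1 d2 dL : measure_display)
    (X1 : measurableType d1) (X2 : measurableType d2) (L : measurableType dL)
    (M : model X1 X2 L R) : Prop :=
  mediation M /\ redundancy M.

Definition agree_on_observables (R : realType) (d1 d2 dA dB : measure_display)
    (X1 : measurableType d1) (X2 : measurableType d2)
    (LA : measurableType dA) (LB : measurableType dB)
    (MA : model X1 X2 LA R) (MB : model X1 X2 LB R) : Prop :=
  forall C : set (X1 * X2)%type, measurable C ->
    MA (fst @^-1` C) = MB (fst @^-1` C).

(* [J] is a joint distribution of X1, X2, LA, LB under which (X1, X2, LA) is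
   distributed as in [MA] and (X1, X2, LB) as in [MB]. *)
Definition joint_distribution (R : realType) (d1 d2 dA dB : measure_display)
    (X1 : measurableType d1) (X2 : measurableType d2)
    (LA : measurableType dA) (LB : measurableType dB)
    (MA : model X1 X2 LA R) (MB : model X1 X2 LB R)
    (J : probability (X1 * X2 * LA * LB)%type R) : Prop :=
  (forall C : set (X1 * X2 * LA)%type, measurable C ->
     J ((fun t => t.1) @^-1` C) = MA C) /\
  (forall C : set (X1 * X2 * LB)%type, measurable C ->
     J ((fun t => (t.1.1, t.2)) @^-1` C) = MB C).

Definition can_guarantee (R : realType) (d1 d2 dA : measure_display)
    (X1 : measurableType d1) (X2 : measurableType d2) (LA : measurableType dA)
    (MA : model X1 X2 LA R) : Prop :=
  forall (dB : measure_display) (LB : measurableType dB)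
    (MB : model X1 X2 LB R),
    mediation MB -> agree_on_observables MA MB ->
    forall J : probability (X1 * X2 * LA * LB)%type R,
      joint_distribution MA MB J ->
      determined_by J (fun t => t.1.2) (fun t => t.2).

(* Main.v *)
Require Import Defs.
From HB Require Import structures.
From mathcomp Require Import all_boot all_order all_algebra.
From mathcomp Require Import all_classical all_reals all_analysis.
From mathcomp Require Import measurable_realfun.

(* If Alice can guarantee, let Bob's latent be a copy of X1, and then of X2:
   given X1, the variable X1 is known, so X1 and X2 are independent, and the
   guarantee says that LA is a function of X1, respectively of X2.

   Conversely, let LA = f1 X1 = f2 X2 almost surely and let A be an event of LA.
   Given LB, the events {f1 X1 in A} and {f2 X2 in A} are independent but almost
   surely equal, so their common conditional probability q satisfies q = q^2.
   Hence q is 0 or 1, and {LA in A} is almost surely an event of LB. As LA is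
   standard Borel, it is coded by a real number phi, and the events {phi <= r}
   for r rational recover LA from LB through phi = inf {r | phi <= r}. *)

Set Implicit Arguments.
Unset Strict Implicit.
Unset Printing Implicit Defensive.

Import Order.TTheory GRing.Theory Num.Theory.
Local Open Scope classical_set_scope.
Local Open Scope ring_scope.

Lemma measurable_preimageT (d d' : measure_display) (T : measurableType d)
    (T' : measurableType d') (f : T -> T') (A : set T') :
  measurable_fun setT f -> measurable A -> measurable (f @^-1` A).
Proof. by move=> mf mA; rewrite -[X in measurable X]setTI; exact: mf. Qed.

(** * Transfer along a map [f] under which the law of [Q] is [P] *)

Section transfer.
Context (R : realType) (d d' : measure_display) (T : measurableType d)
  (S : measurableType d') (P : probability T R) (Q : probability S R)
  (f : S -> T).
Hypotheses (mf : measurable_fun setT f)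
  (QfP : forall C : set T, measurable C -> Q (f @^-1` C) = P C).

Lemma integrable_image (g : T -> \bar R) : measurable_fun setT g ->
  P.-integrable setT g <-> Q.-integrable setT (g \o f).
Proof.
move=> mg.
have E : (\int[Q]_x `|(g \o f) x| = \int[P]_x `|g x|)%E.
  rewrite -[LHS](@ge0_integral_pushforward _ _ _ _ _ _ mf Q setT (abse \o g))//.
  - by apply: eq_measure_integral => A mA _; exact: QfP.
  - exact: measurableT_comp.
  - by move=> x _; exact: abse_ge0.
split=> /integrableP[_ gf]; apply/integrableP; split => //.
- exact: measurableT_comp.
- by rewrite E.
- by rewrite -E.
Qed.

Lemma integral_image (g : T -> \bar R) (D : set T) : measurable D ->
    measurable_fun setT g -> P.-integrable setT g ->
  (\int[P]_(x in D) g x = \int[Q]_(x in f @^-1` D) g (f x))%E.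
Proof.
move=> mD mg ig.
rewrite -[RHS](@integral_pushforward _ _ _ _ _ _ mf Q D g)//.
  by apply: eq_measure_integral => A mA _; exact/esym/QfP.
apply: (@integrableS _ _ _ _ setT) => //; first exact: measurable_preimageT.
by apply/integrable_image.
Qed.

Lemma ae_image (A : T -> Prop) :
  {ae P, forall x, A x} -> {ae Q, forall x, A (f x)}.
Proof.
move=> [N [mN N0 AN]]; exists (f @^-1` N); split.
- exact: measurable_preimageT.
- by rewrite QfP.
- by move=> x /= Ax; exact: AN.
Qed.

Lemma is_cond_prob_image (dZ : measure_display) (Z : measurableType dZ)
    (E : set T) (z : T -> Z) (q : Z -> R) :
    measurable E -> measurable_fun setT z ->
  is_cond_prob P E z q <-> is_cond_prob Q (f @^-1` E) (z \o f) q.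
Proof.
move=> mE mz.
have mqz : measurable_fun setT q ->
    measurable_fun setT (fun t => (q (z t))%:E).
  by move=> mq; apply/measurable_EFinP; exact: measurableT_comp.
split=> -[mq iq qE]; split => //.
- by apply/(integrable_image (mqz mq)).
- move=> C mC; have mzC := measurable_preimageT mz mC.
  rewrite -[RHS](integral_image mzC (mqz mq) iq) -qE//.
  by rewrite -QfP//; exact: measurableI.
- by apply/(integrable_image (mqz mq)).
- move=> C mC; have mzC := measurable_preimageT mz mC.
  rewrite (integral_image mzC (mqz mq)); last first.
    by apply/(integrable_image (mqz mq)).
  by rewrite -qE// -QfP//; exact: measurableI.
Qed.

(** Conditional independence depends only on joint laws. The equivalence serves in both directions:
    to check mediation for a model built as an image law, and to lift mediation from Bob's model to
    the joint distribution. *)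
Lemma cond_indep_image (d1 d2 dZ : measure_display) (X1 : measurableType d1)
    (X2 : measurableType d2) (Z : measurableType dZ)
    (x1 : T -> X1) (x2 : T -> X2) (z : T -> Z) :
    measurable_fun setT x1 -> measurable_fun setT x2 ->
    measurable_fun setT z ->
  cond_indep P x1 x2 z <-> cond_indep Q (x1 \o f) (x2 \o f) (z \o f).
Proof.
move=> mx1 mx2 mz.
have icp E q mE := @is_cond_prob_image dZ Z E z q mE mz.
split=> ci B1 B2 mB1 mB2; have [q1 [q2 [h1 h2 h12]]] := ci _ _ mB1 mB2;
  have m1 := measurable_preimageT mx1 mB1;
  have m2 := measurable_preimageT mx2 mB2;
  have m12 := measurableI _ _ m1 m2;
  by exists q1, q2; split; [apply/(icp _ _ m1)|apply/(icp _ _ m2)|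
    apply/(icp _ _ m12)].
Qed.

End transfer.

(** * Conditional probabilities and conditional independence *)

Section conditional_probability.
Context (R : realType) (d dZ : measure_display) (T : measurableType d)
  (Z : measurableType dZ) (P : probability T R).

(** The version is the Radon-Nikodym derivative, with respect to the law of z, of the measure
    sending C to the probability that E occurs and z lies in C. *)
Lemma cond_prob_exists (E : set T) (z : T -> Z) :
    measurable E -> measurable_fun setT z ->
  exists q, is_cond_prob P E z q.
Proof.
move=> mE mz.
pose z' : {mfun T >-> Z} := mfun_Sub (mem_set mz).
pose mu : probability Z R := distribution P z'.
have muE C : measurable C -> P (z @^-1` C) = mu C by [].
have PE : (P E < +oo)%E by rewrite ltey_eq fin_num_measure.
pose nu' : {charge set Z -> \bar R} :=
  pushforward (charge_of_finite_measure (mfrestr mE PE)) z.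
pose nu := nu' mz.
have numu : nu `<< mu.
  apply/null_content_dominatesP => A mA muA0.
  apply: (@subset_measure0 _ _ _ P _ (z @^-1` A)) => //.
  - by apply: measurableI => //; exact: measurable_preimageT.
  - exact: measurable_preimageT.
(* The derivative is finite at every point, so [fine] makes it real valued without changing it. *)
have qE l : (fine (Radon_Nikodym nu mu l))%:E = Radon_Nikodym nu mu l.
  by rewrite fineK// Radon_Nikodym_fin_num.
have mRN : measurable_fun setT (Radon_Nikodym nu mu).
  exact: measurable_int (Radon_Nikodym_integrable numu).
exists (fun l => fine (Radon_Nikodym nu mu l)); split.
- exact: measurableT_comp.
- under eq_fun do rewrite qE.
  apply/(integrable_image mz muE mRN).
  exact: Radon_Nikodym_integrable.
- move=> C mC; under eq_integral do rewrite qE.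
  rewrite -(integral_image mz muE mC mRN) ?Radon_Nikodym_integrable//.
  by rewrite -Radon_Nikodym_integral// setIC.
Qed.

(** Serves to replace the events {f1 X1 in A} and {f2 X2 in A} by {LA in A}. *)
Lemma is_cond_prob_ae (E E' : set T) (z : T -> Z) (q : Z -> R) :
    measurable E -> measurable E' -> measurable_fun setT z ->
    {ae P, forall t, E t <-> E' t} ->
  is_cond_prob P E z q -> is_cond_prob P E' z q.
Proof.
move=> mE mE' mz EE' [mq iq qE]; split => // C mC.
have mzC := measurable_preimageT mz mC.
rewrite -qE// -!integral_indic; [|exact: mzC|exact: mE|exact: mzC|exact: mE'].
apply: ae_eq_integral => //.
- by apply/measurable_EFinP/measurable_funTS; exact: measurable_indic.
- by apply/measurable_EFinP/measurable_funTS; exact: measurable_indic.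
- apply: filterS EE' => t EE' _; rewrite !indicE.
  by congr (nat_of_bool _)%:R%:E; apply/idP/idP; rewrite !inE => /EE'.
Qed.

Lemma is_cond_probT (z : T -> Z) :
  measurable_fun setT z -> is_cond_prob P setT z (cst 1).
Proof.
move=> mz; split => //.
- exact: finite_measure_integrable_cst.
- move=> C mC; have mzC := measurable_preimageT mz mC.
  by rewrite setTI [RHS](integral_cst P mzC 1) mul1e.
Qed.

(** The factor [\1_B] restricts integrals to the preimage of B, so the identity for q at the
    intersection of B and D yields the one at D. *)
Lemma is_cond_prob_known (B : set Z) (E : set T) (z : T -> Z) (q : Z -> R) :
    measurable_fun setT z -> measurable B -> is_cond_prob P E z q ->
  is_cond_prob P (z @^-1` B `&` E) z (fun l => \1_B l * q l).
Proof.
move=> mz mB [mq iq qE].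
have E1 :
    (fun t => (\1_B (z t) * q (z t))%:E) = (EFin \o q \o z) \_ (z @^-1` B).
  apply/funext => t; rewrite patchE /= indicE.
  rewrite -[in RHS]/(t \in z @^-1` B).
  have -> : (t \in z @^-1` B) = (z t \in B) by apply/idP/idP; rewrite !inE.
  by case: ifP => _; rewrite ?mul1r ?mul0r.
split.
- by apply: measurable_funM.
- have mzB := measurable_preimageT mz mB.
  by rewrite E1 -integrable_mkcond//; apply: (integrableS _ mzB _ iq).
- move=> D mD; rewrite E1 -integral_mkcondr -preimage_setI.
  rewrite setIAC -preimage_setI setIC (setIC D) qE//.
  exact: measurableI.
Qed.

(** Given z, the event {z in B1} is decided: its conditional probability is [\1_B1], which factors
    out of that of the joint event. *)
Lemma cond_indep_self (d2 : measure_display) (X2 : measurableType d2)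
    (z : T -> Z) (x2 : T -> X2) :
    measurable_fun setT z -> measurable_fun setT x2 ->
  cond_indep P z x2 z.
Proof.
move=> mz mx2 B1 B2 mB1 mB2.
have [q2 h2] := cond_prob_exists (measurable_preimageT mx2 mB2) mz.
exists \1_B1, q2; split => //; last exact: is_cond_prob_known.
(* The event {z in B1} is intersected with the sure event, of conditional probability 1. *)
rewrite -[X in is_cond_prob P X _ _]setIT.
have -> : \1_B1 = (fun l => \1_B1 l * cst 1 l) :> (Z -> R).
  by apply/funext => l /=; rewrite mulr1.
by apply: is_cond_prob_known => //; exact: is_cond_probT.
Qed.

Lemma cond_indep_sym (d1 d2 : measure_display) (X1 : measurableType d1)
    (X2 : measurableType d2) (x1 : T -> X1) (x2 : T -> X2) (z : T -> Z) :
  cond_indep P x1 x2 z -> cond_indep P x2 x1 z.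
Proof.
move=> ci B2 B1 mB2 mB1; have [q1 [q2 [h1 h2 h12]]] := ci _ _ mB1 mB2.
exists q2, q1; split => //; rewrite setIC.
by under eq_fun do rewrite mulrC.
Qed.

(** Versions agree almost surely, so q1 = q2 and q1 = q1 * q2 = q1^2. Then C is the set where q1 is
    1. *)
Lemma zero_one_cond_prob (E : set T) (z : T -> Z) (q1 q2 : Z -> R) :
    measurable E -> measurable_fun setT z ->
    is_cond_prob P E z q1 -> is_cond_prob P E z q2 ->
    is_cond_prob P E z (fun l => q1 l * q2 l) ->
  exists2 C : set Z, measurable C & {ae P, forall t, E t <-> C (z t)}.
Proof.
move=> mE mz [mq1 iq1 qE1] [mq2 iq2 qE2] [mq12 iq12 qE12].
pose z' : {mfun T >-> Z} := mfun_Sub (mem_set mz).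
pose mu : probability Z R := distribution P z'.
have muE C : measurable C -> P (z @^-1` C) = mu C by [].
(* Uniqueness of versions: under the law of z, both have the same integral over every measurable
   set. *)
have aeq (q q' : Z -> R) : measurable_fun setT q -> measurable_fun setT q' ->
    P.-integrable setT (fun t => (q (z t))%:E) ->
    P.-integrable setT (fun t => (q' (z t))%:E) ->
    (forall C, measurable C -> P (E `&` z @^-1` C) =
      (\int[P]_(t in z @^-1` C) (q (z t))%:E)%E) ->
    (forall C, measurable C -> P (E `&` z @^-1` C) =
      (\int[P]_(t in z @^-1` C) (q' (z t))%:E)%E) ->
    {ae mu, forall l, q l = q' l}.
  move=> /measurable_EFinP mq /measurable_EFinP mq' iq iq' qE qE'.
  have iq0 : mu.-integrable setT (EFin \o q).
    exact/(integrable_image mz muE mq).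
  have iq0' : mu.-integrable setT (EFin \o q').
    exact/(integrable_image mz muE mq').
  have : ae_eq mu setT (EFin \o q) (EFin \o q').
    apply: integral_ae_eq => // C _ mC.
    rewrite (integral_image mz muE mC mq iq0).
    by rewrite (integral_image mz muE mC mq' iq0') -qE -?qE'.
  by apply: filterS => l /(_ I)[].
have e12 := aeq _ _ mq1 mq2 iq1 iq2 qE1 qE2.
have e13 := aeq _ _ mq1 mq12 iq1 iq12 qE1 qE12.
have q01 : {ae P, forall t, q1 (z t) = 0 \/ q1 (z t) = 1}.
  apply: (ae_image mz muE (A := fun l => q1 l = 0 \/ q1 l = 1)).
  apply: filterS2 e12 e13 => l e12 e13.
  move: e13; rewrite -e12 => /eqP; rewrite -subr_eq0 -{1}[q1 l]mulr1 -mulrBr.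
  by rewrite mulf_eq0 subr_eq0 => /orP[/eqP|/eqP/esym]; [left|right].
pose C : set Z := [set l | q1 l = 1].
have mC : measurable C.
  by rewrite (_ : C = q1 @^-1` [set 1])//; exact: measurable_preimageT.
have mzC := measurable_preimageT mz mC.
have mzC' := measurable_preimageT mz (measurableC mC).
have mq1z : measurable_fun setT (fun t => (q1 (z t))%:E).
  by apply/measurable_EFinP; exact: measurableT_comp.
exists C => //.
(* Where z is outside C, q1 vanishes almost surely and E is null; where z is in C, q1 is 1 and E has
   full probability. *)
have EC0 : P (E `&` z @^-1` (~` C)) = 0.
  rewrite qE1; last exact: measurableC.
  rewrite (@ae_eq_integral _ _ _ _ _ (cst 0%E)) ?integral0//.
    exact: measurable_funTS.
  by apply: filterS q01 => t [-> //|qt /(_ qt)].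
have CE : P (z @^-1` C `&` E) = P (z @^-1` C).
  rewrite setIC qE1//.
  rewrite (@eq_integral _ _ _ _ _ (cst 1%E)); last first.
    by move=> t; rewrite inE => ->.
  by rewrite integral_cst// mul1e.
have CE0 : P (z @^-1` C `\` E) = 0.
  rewrite measureD//; last by rewrite ltey_eq fin_num_measure.
  by rewrite [X in (_ - X)%E]CE subee// fin_num_measure.
apply: (@negligibleS _ _ _ _ ((E `&` z @^-1` (~` C)) `|` (z @^-1` C `\` E))).
  move=> t /= ECt; have [Et|Et] := pselect (E t).
    by left; split => // Ct; apply: ECt.
  by right; split => //; apply: contrapT => Ct; apply: ECt.
apply: negligibleU.
  by apply/negligibleP => //; apply: measurableI.
by apply/negligibleP => //; exact: measurableD.
Qed.

End conditional_probability.

(** * Recovering a standard Borel variable from countably many events *)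

(** A real is the infimum of the rationals above it. Indices that code no rational stand for 0, and
    rationals below x are replaced by +oo. *)
Lemma einfs_rat_upper (R : realType) (x : R) :
  einfs (fun n => let r : R := ratr (odflt 0 (unpickle n)) in
                  if x <= r then r%:E else +oo%E) 0 = x%:E.
Proof.
apply/eqP; rewrite eq_le; apply/andP; split; last first.
  apply: le_ereal_inf_tmp => _ [n _ <-] /=.
  by case: ifPn => [|_]; rewrite ?lee_fin// leey.
apply/lee_addgt0Pr => e e0; have xe : x < x + e by rewrite ltrDl.
have [r] := rat_in_itvoo xe; rewrite in_itv /= => /andP[xr rxe].
apply: ge_ereal_inf.
exists (ratr r)%:E; last by rewrite -EFinD lee_fin ltW.
have [n rn] : exists n, odflt 0 (unpickle n) = r.
  by exists (pickle r); rewrite pickleK.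
by exists n => //=; rewrite rn ltW.
Qed.

(** Only countably many cuts phi <= r are used, so their exceptional null sets merge into one. *)
Lemma determined_by_events (R : realType) (d dY dZ : measure_display)
    (T : measurableType d) (Y : measurableType dY) (Z : measurableType dZ)
    (P : probability T R) (y : T -> Y) (z : T -> Z) :
    standard_borel R Y ->
    (forall A : set Y, measurable A ->
      exists2 C : set Z, measurable C &
        {ae P, forall t, A (y t) <-> C (z t)}) ->
  determined_by P y z.
Proof.
move=> [phi [mphi iphi phiE]] yz.
pose r n : R := ratr (odflt 0 (unpickle n)).
have /choice[C CP] : forall n, exists C : set Z, measurable C /\
    {ae P, forall t, phi (y t) <= r n <-> C (z t)}.
  move=> n; have mn : measurable (phi @^-1` `]-oo, r n]).
    exact: measurable_preimageT.
  by have [C mC yC] := yz _ mn; exists C.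
(* The infimum of [einfs_rat_upper], with each test phi <= r n replaced by membership in [C n],
   which needs only the value of z. *)
pose h l := fine (einfs (fun n => if l \in C n then (r n)%:E else +oo%E) 0).
have mh : measurable_fun setT h.
  apply: measurableT_comp => //; apply: measurable_fun_einfs => n.
  apply: measurable_fun_ifT => //; apply: (measurable_fun_bool true).
  rewrite setTI (_ : _ @^-1` _ = C n); first by have [] := CP n.
  by apply/seteqP; split => l; [exact: set_mem|exact: mem_set].
have hz : {ae P, forall t, h (z t) = phi (y t)}.
  have : {ae P, forall t, forall n, phi (y t) <= r n <-> C n (z t)}.
    by apply: ae_foralln => n; have [] := CP n.
  apply: filterS => t yC; rewrite /h -[RHS]/(fine (phi (y t))%:E).
  rewrite -[in RHS]einfs_rat_upper; congr (fine (einfs _ 0)).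
  apply/funext => n; rewrite -/(r n); congr (if _ then _ else _).
  by apply/idP/idP; rewrite inE => /yC.
(* The inverse of phi applied to [h]; values of [h] outside the range of phi are sent to [point]. *)
pose g l := if pselect (exists a, phi a = h l) is left e
  then sval (cid e) else point.
have gh l a : phi a = h l -> g l = a.
  move=> al; rewrite /g; case: pselect => [e|[]]; last by exists a.
  by apply: iphi; rewrite (svalP (cid e)).
have mrange : measurable (range phi) by exact: phiE.
exists g; last first.
  by apply: filterS hz => t hzt; apply/esym/gh.
move=> _ A mA; rewrite setTI.
(* The second piece collects the values sent to the default [point], and is present only if that
   point lies in A. *)
rewrite (_ : g @^-1` A = h @^-1` (phi @` A) `|`
    (if point \in A then h @^-1` (~` range phi) else set0)).
  apply: measurableU; first by apply: (measurable_preimageT mh); exact: phiE.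
  by case: ifP => // _; apply: (measurable_preimageT mh); exact: measurableC.
apply/seteqP; split => l /=.
- have [[a al]|nl] := pselect (exists a, phi a = h l).
    by move=> Agl; left; exists a => //; rewrite -(gh _ _ al).
  rewrite {1}/g; case: pselect => // _ Ap; right.
  by rewrite mem_set//= => -[a _ al]; apply: nl; exists a.
- move=> [[a Aa al]|]; first by rewrite (gh _ _ al).
  case: ifPn => // /set_mem Ap nl; rewrite /g; case: pselect => // -[a al].
  by case: nl; exists a.
Qed.

(** * The two implications *)

(** Bob may use as latent any function z of the observables given which they are independent: his
    model is the law of (X1, X2, z) under [MA], and the joint distribution that of (X1, X2, LA,
    z). *)
Lemma guaranteed_by_observables (R : realType) (d1 d2 dA dZ : measure_display)
    (X1 : measurableType d1) (X2 : measurableType d2) (LA : measurableType dA)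
    (Z : measurableType dZ) (MA : model X1 X2 LA R) (z : X1 * X2 -> Z) :
    can_guarantee MA -> measurable_fun setT z ->
    cond_indep MA (fun t => t.1.1) (fun t => t.1.2) (fun t => z t.1) ->
  determined_by MA (fun t => t.2) (fun t => z t.1).
Proof.
move=> gA mz ci.
have mz1 : measurable_fun setT (fun t : X1 * X2 * LA => z t.1).
  exact: measurableT_comp.
have mfB : measurable_fun setT (fun t : X1 * X2 * LA => (t.1, z t.1)).
  exact: measurable_fun_pair.
have mfJ : measurable_fun setT (fun t : X1 * X2 * LA => (t, z t.1)).
  exact: measurable_fun_pair.
pose MB : model X1 X2 Z R := distribution MA (mfun_Sub (mem_set mfB)).
pose J : probability (X1 * X2 * LA * Z)%type R :=
  distribution MA (mfun_Sub (mem_set mfJ)).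
have medB : mediation MB.
  have mx1 : measurable_fun setT (fun t : X1 * X2 * Z => t.1.1).
    exact: measurableT_comp.
  have mx2 : measurable_fun setT (fun t : X1 * X2 * Z => t.1.2).
    exact: measurableT_comp.
  have mz2 : measurable_fun setT (fun t : X1 * X2 * Z => t.2).
    exact: measurable_snd.
  have MBE C : measurable C ->
    MA ((fun t => (t.1, z t.1)) @^-1` C) = MB C by [].
  exact: (cond_indep_image mfB MBE mx1 mx2 mz2).2 ci.
(* Agreement and both marginals of [J] hold by computation, [MB] and [J] being image laws of
   [MA]. *)
have [g mg gJ] := gA _ _ MB medB (fun C mC => erefl) J
  (conj (fun C mC => erefl) (fun C mC => erefl)).
exists g => //.
exact: (ae_image mfJ (P := J) (Q := MA) _ gJ).
Qed.

Theorem theorem2 (R : realType) (d1 d2 dA : measure_display)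
    (X1 : measurableType d1) (X2 : measurableType d2) (LA : measurableType dA)
    (LA_borel : standard_borel R LA)
    (MA : model X1 X2 LA R) (mediationA : mediation MA) :
  can_guarantee MA <-> natural_latent MA.
Proof.
split=> [gA|[_ [[f1 mf1 f1A] [f2 mf2 f2A]]]].
  have mx1 : measurable_fun setT (fun t : X1 * X2 * LA => t.1.1).
    exact: measurableT_comp.
  have mx2 : measurable_fun setT (fun t : X1 * X2 * LA => t.1.2).
    exact: measurableT_comp.
  split; [exact: mediationA|split].
  - apply: (guaranteed_by_observables gA (z := fst)) => //.
    exact: cond_indep_self.
  - apply: (guaranteed_by_observables gA (z := snd)) => //.
    exact/cond_indep_sym/cond_indep_self.
move=> dB LB MB medB agree J [JA JB].
pose pA (t : X1 * X2 * LA * LB) := t.1.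
pose pB (t : X1 * X2 * LA * LB) := (t.1.1, t.2).
have mpA : measurable_fun setT pA by exact: measurable_fst.
have mpB : measurable_fun setT pB.
  by apply: measurable_fun_pair => //; exact: measurableT_comp.
have mx1 : measurable_fun setT (fun t : X1 * X2 * LB => t.1.1).
  exact: measurableT_comp.
have mx2 : measurable_fun setT (fun t : X1 * X2 * LB => t.1.2).
  exact: measurableT_comp.
have ciJ : cond_indep J (fun t => t.1.1.1) (fun t => t.1.1.2) (fun t => t.2).
  have mz : measurable_fun setT (fun t : X1 * X2 * LB => t.2).
    exact: measurable_snd.
  exact: (cond_indep_image (P := MB) mpB JB mx1 mx2 mz).1 medB.
have f1J := ae_image mpA JA f1A; have f2J := ae_image mpA JA f2A.
apply: determined_by_events LA_borel _ => A mA.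
pose E : set (X1 * X2 * LA * LB) := [set t | A t.1.2].
have mE : measurable E.
  have mL : measurable_fun setT (fun t : X1 * X2 * LA * LB => t.1.2).
    exact: measurableT_comp.
  exact: (measurable_preimageT mL mA).
(* Both chosen events coincide almost surely with [E], and so does their intersection; thus q1, q2
   and q1 * q2 are all versions for [E]. *)
have [q1 [q2 [h1 h2 h12]]] := ciJ (f1 @^-1` A) (f2 @^-1` A)
  (measurable_preimageT mf1 mA) (measurable_preimageT mf2 mA).
have mz : measurable_fun setT (fun t : X1 * X2 * LA * LB => t.2).
  exact: measurable_snd.
have mE1 : measurable [set t : X1 * X2 * LA * LB | A (f1 t.1.1.1)].
  apply: (measurable_preimageT (f := fun t => f1 t.1.1.1)) => //.
  by do 3! apply: measurableT_comp => //.
have mE2 : measurable [set t : X1 * X2 * LA * LB | A (f2 t.1.1.2)].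
  apply: (measurable_preimageT (f := fun t => f2 t.1.1.2)) => //.
  by do 3! apply: measurableT_comp => //.
apply: (zero_one_cond_prob mE mz).
- by apply: (is_cond_prob_ae mE1 mE mz _ h1); apply: filterS f1J => t /= <-.
- by apply: (is_cond_prob_ae mE2 mE mz _ h2); apply: filterS f2J => t /= <-.
- apply: (is_cond_prob_ae (measurableI _ _ mE1 mE2) mE mz _ h12).
  by apply: filterS2 f1J f2J => t /= <- <-; split=> [[]|].
Qed.
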